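(* Let $(B_0,B_1)$ be a Banach pair and let $\theta\in(0,1)$. If $x\in B_0\cap B_1$, then $$\|x\|_{\langle B_0,B_1\rangle_\theta}=\inf\Big\{\max_{j=0,1}\big\|\{2^{(j-\theta)n}c_n\}_{n\in\mathbb{Z}}\big\|_{UC(B_j)}:\ x=\sum_{n\in\mathbb{Z}}c_n,\ \{c_n\}_{n\in\mathbb{Z}}\in\mathcal{J}_0(\bar B)\Big\},$$ where $\mathcal{J}_0(\bar B)$ is the set of finitely supported $B_0\cap B_1$-valued sequences indexed by $\mathbb{Z}$.
   Context: Banach spaces are over $\mathbb{C}$. A Banach pair $\bar B=(B_0,B_1)$ consists of two Banach spaces continuously embedded in some Hausdorff topological vector space. For a Banach space $B$, $UC(B)$ is the Banach space of all $B$-valued sequences $\{b_n\}_{n\in\mathbb{Z}}$ such that $\sum_{n\in\mathbb{Z}}\lambda_nb_n$ converges for all complex sequences $\{\lambda_n\}_{n\in\mathbb{Z}}$ with $|\lambda_n|\le1$ for all $n$, normed by $\|\{b_n\}\|_{UC(B)}=\sup\|\sum_{n\in F}\lambda_nb_n\|_B$, the supremum being over all finite $F\subset\mathbb{Z}$ and all complex $\{\lambda_n\}$ with $|\lambda_n|\le1$ for all $n$. The Peetre (''$\pm$'' method) space $\langle B_0,B_1\rangle_\theta$ consists of all $x\in B_0+B_1$ having a representation $x=\sum_{n\in\mathbb{Z}}c_n$ (convergence in $B_0+B_1$) with $c_n\in B_0\cap B_1$ and $\{2^{(j-\theta)n}c_n\}_{n\in\mathbb{Z}}\in UC(B_j)$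 for $j=0,1$; its norm is $\|x\|_{\langle B_0,B_1\rangle_\theta}=\inf\max_{j=0,1}\|\{2^{(j-\theta)n}c_n\}_{n\in\mathbb{Z}}\|_{UC(B_j)}$, the infimum being over all such representations. *)

(* Defs.v *)
From HB Require Import structures.
From mathcomp Require Import all_boot all_order all_algebra.
From mathcomp Require Import finmap complex.
From mathcomp Require Import all_classical all_reals all_analysis.

Set Implicit Arguments.
Unset Strict Implicit.
Unset Printing Implicit Defensive.

Import Order.TTheory GRing.Theory Num.Theory.
Import numFieldNormedType.Exports.

Local Open Scope classical_set_scope.
Local Open Scope complex_scope.
Local Open Scope ring_scope.

(* The norm of a normed space over R[i] takes its values in R[i], where they
   are nonnegative reals; [rnorm] is the same number seen in R. *)
Definition rnorm (R : realType) (V : normedModType R[i]) (v : V) : R :=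
  complex.Re `|v|.

Record banach_pair (R : realType) := BanachPair {
  ambient : topologicalLmodType R[i];
  space0 : completeNormedModType R[i];
  space1 : completeNormedModType R[i];
  emb0 : {linear space0 -> ambient};
  emb1 : {linear space1 -> ambient};
  ambient_hausdorff : hausdorff_space ambient;
  emb0_inj : injective emb0;
  emb1_inj : injective emb1;
  emb0_continuous : continuous emb0;
  emb1_continuous : continuous emb1
}.

(* An element of the intersection of the two spaces: a point of the ambient
   space together with its (unique) preimages under the two embeddings. *)
Record pair_cap (R : realType) (B : banach_pair R) := PairCap {
  cap_val :> ambient B;
  cap0 : space0 B;
  cap1 : space1 B;
  emb_cap0 : emb0 B cap0 = cap_val;
  emb_cap1 : emb1 B cap1 = cap_val
}.

(* The norm of v in the sum of the two spaces; it is +oo exactly when v is not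
   in the sum. *)
Definition sum_norm (R : realType) (B : banach_pair R) (v : ambient B) :
    \bar R :=
  ereal_inf [set r | exists b0 b1,
    emb0 B b0 + emb1 B b1 = v /\ r = (rnorm b0 + rnorm b1)%:E].

(* The sum of b n over - p.1 <= n < p.2. A two-sided series converges when
   these sums have a limit as p.1 and p.2 tend to infinity independently. *)
Definition zpartial (M : zmodType) (b : int -> M) (p : nat * nat) : M :=
  \sum_(0 <= k < p.1) b (- k.+1%:Z) + \sum_(0 <= k < p.2) b k%:Z.

Definition zlimit : set_system (nat * nat) := filter_prod \oo \oo.

Definition unit_bounded (R : realType) (lam : int -> R[i]) : Prop :=
  forall n, `|lam n| <= 1.

Definition UC (R : realType) (V : normedModType R[i]) : set (int -> V) :=
  [set b | forall lam : int -> R[i], unit_bounded lam ->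
    cvg (zpartial (fun n => lam n *: b n) @ zlimit)].

Definition UC_norm (R : realType) (V : normedModType R[i]) (b : int -> V) :
    \bar R :=
  ereal_sup [set r | exists (F : {fset int}) (lam : int -> R[i]),
    unit_bounded lam /\ r = (rnorm (\sum_(n <- F) lam n *: b n))%:E].

Definition weighted (R : realType) (V : normedModType R[i]) (theta : R)
    (j : nat) (b : int -> V) : int -> V :=
  fun n => (2 `^ ((j%:R - theta) * n%:~R))%:C *: b n.

Definition sum_converges (R : realType) (B : banach_pair R)
    (c : int -> pair_cap B) (x : ambient B) : Prop :=
  sum_norm (x - zpartial (fun n => c n : ambient B) p) @[p --> zlimit]
    --> 0%E.

Definition peetre_representation (R : realType) (B : banach_pair R)
    (theta : R) (x : ambient B) : set (int -> pair_cap B) :=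
  [set c | [/\ sum_converges c x,
    UC (weighted theta 0 (fun n => cap0 (c n))) &
    UC (weighted theta 1 (fun n => cap1 (c n)))]].

Definition peetre_cost (R : realType) (B : banach_pair R) (theta : R)
    (c : int -> pair_cap B) : \bar R :=
  maxe (UC_norm (weighted theta 0 (fun n => cap0 (c n))))
       (UC_norm (weighted theta 1 (fun n => cap1 (c n)))).

(* The value is +oo when x has no representation, i.e. is not in the Peetre
   space. *)
Definition peetre_norm (R : realType) (B : banach_pair R) (theta : R)
    (x : ambient B) : \bar R :=
  ereal_inf [set peetre_cost theta c | c in peetre_representation theta x].

Definition J0 (R : realType) (B : banach_pair R) : set (int -> pair_cap B) :=
  [set c | finite_set [set n | (c n : ambient B) != 0]].

(* Main.v *)
Require Import Defs.
From HB Require Import structures.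
From mathcomp Require Import all_boot all_order all_algebra.
From mathcomp Require Import finmap complex.
From mathcomp Require Import all_classical all_reals all_analysis.
From mathcomp Require Import ring.
Set Implicit Arguments.
Unset Strict Implicit.
Unset Printing Implicit Defensive.
Import Order.TTheory GRing.Theory Num.Theory.
Import numFieldNormedType.Exports.
Local Open Scope classical_set_scope.
Local Open Scope ring_scope.

(** Let c represent x. Both tails p- (over n < -N) and p+ (over n >= N) of the
    series converge, p- in B_0 and p+ in B_1; since p- + p+ is x minus finitely
    many terms, both tails lie in the intersection. Replace c outside [-N, N) by
    p- at the index -N-1 and p+ at the index N. Membership in UC is used only to
    get the weighted terms w_n -> 0: with q = 2^-theta or q = 2^(theta-1), the
    weighted norm of a tail in the space where it converges is bounded by a
    geometric sum times sup |w_n|, while in the other space it satisfies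
    u_(N+1) <= q u_N + o(1). All four weighted norms thus tend to 0, and the
    UC norm changes by at most their sum. *)

(** * Real-valued norms and geometrically weighted tails of series *)

Section real_norm.
Local Open Scope complex_scope.
Context {R : realType} {V : normedModType R[i]}.
Implicit Types (v w : V) (d : nat -> V).

Lemma normE_rnorm v : `|v| = (rnorm v)%:C.
Proof. by rewrite /rnorm RRe_real// ger0_real. Qed.

Lemma rnorm_ge0 v : 0 <= rnorm v.
Proof. by rewrite -ler0c -normE_rnorm. Qed.

Lemma rnorm0 : rnorm (0 : V) = 0.
Proof. by rewrite /rnorm normr0. Qed.

Lemma rnormN v : rnorm (- v) = rnorm v.
Proof. by rewrite /rnorm normrN. Qed.

Lemma ler_rnormD v w : rnorm (v + w) <= rnorm v + rnorm w.
Proof. by rewrite -lecR rmorphD/= -!normE_rnorm ler_normD. Qed.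

Lemma ler_rnormB v w : rnorm (v - w) <= rnorm v + rnorm w.
Proof. by rewrite -(rnormN w) ler_rnormD. Qed.

Lemma rnormZ_ge0 (r : R) v : 0 <= r -> rnorm (r%:C *: v) = r * rnorm v.
Proof.
move=> r0; apply: complexI; rewrite -normE_rnorm normrZ ger0_norm ?ler0c//.
by rewrite normE_rnorm rmorphM.
Qed.

Lemma ler_rnormZ (a : R[i]) v : `|a| <= 1 -> rnorm (a *: v) <= rnorm v.
Proof. by move=> a1; rewrite -lecR -!normE_rnorm normrZ ler_piMl. Qed.

(** A positive element of [R[i]] is real, so tolerances in [R] suffice. *)
Lemma cvg_rnormP {T : Type} {F : set_system T} {FF : Filter F} (f : T -> V)
    (l : V) :
  f @ F --> l <-> forall e : R, 0 < e -> \forall t \near F, rnorm (l - f t) < e.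
Proof.
rewrite (cvgrPdist_lt (FF := FF)); split => [fl e e0|fl e e0].
  have := fl e%:C; rewrite ltcR => /(_ e0); apply: filterS => t.
  by rewrite normE_rnorm ltcR.
have eE : e = (complex.Re e)%:C by rewrite RRe_real// gtr0_real.
move: e0; rewrite eE ltcR => /fl; apply: filterS => t.
by rewrite normE_rnorm ltcR.
Qed.

Lemma nbhs0_rnorm (A : set V) : nbhs 0 A ->
  exists2 r : R, 0 < r & forall w, rnorm w < r -> A w.
Proof.
move=> /nbhs_ballP[e /= e0 eA].
have eE : e = (complex.Re e)%:C by rewrite RRe_real// gtr0_real.
exists (complex.Re e); first by rewrite -ltcR -eE.
move=> w we; apply: eA; rewrite -ball_normE /ball_/= sub0r normrN.
by rewrite eE normE_rnorm ltcR.
Qed.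

(** The terms are o(q^k), so the tail from k on is bounded by o(1) times the geometric sum q^k / (1
    - q). *)
Lemma cvg_scaled_series_tail d (p : V) (q : R) : 0 < q -> q < 1 ->
  q^-1 ^+ k * rnorm (d k) @[k --> \oo] --> 0 ->
  series d @ \oo --> p ->
  q^-1 ^+ k * rnorm (p - series d k) @[k --> \oo] --> 0.
Proof.
move=> q0 q1 d0 dp; apply/cvgrPdist_lt => e e0.
(* The factor 1 - q cancels the geometric sum; the half leaves room for a strict inequality. *)
have e'0 : 0 < e * (1 - q) / 2 by rewrite divr_gt0// mulr_gt0// subr_gt0.
move/cvgrPdist_lt : d0 => /(_ _ e'0)[N0 _ dN0]; exists N0 => // N /= N0N.
have dle k : (N <= k)%N -> rnorm (d k) <= e * (1 - q) / 2 * q ^+ k.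
  move=> Nk; have /= := dN0 _ (leq_trans N0N Nk).
  rewrite sub0r normrN ger0_norm; last first.
    by rewrite mulr_ge0 ?rnorm_ge0// exprn_ge0// invr_ge0 ltW.
  by rewrite exprVn mulrC ltr_pdivrMr ?exprn_gt0// => /ltW.
(* Finite geometric sum, multiplied through by 1 - q so that the induction involves no division by
   it. *)
have Sle m : (1 - q) * rnorm (series d (N + m)%N - series d N) <=
    e * (1 - q) / 2 * q ^+ N * (1 - q ^+ m).
  elim: m => [|m IH]; first by rewrite addn0 subrr rnorm0 expr0 subrr !mulr0.
  rewrite addnS seriesSr addrAC.
  apply: (@le_trans _ _ ((1 - q) * (rnorm (series d (N + m)%N - series d N)
                                    + rnorm (d (N + m)%N)))).
    by rewrite ler_wpM2l ?ler_rnormD// subr_ge0 ltW.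
  rewrite mulrDr (le_trans (lerD IH (ler_wpM2l _ (dle _ (leq_addr m N)))))//.
    by rewrite subr_ge0 ltW.
  by rewrite exprD exprS le_eqVlt; apply/orP; left; apply/eqP; ring.
(* Passage to the limit in m, with an arbitrary slack [r]. *)
have tail : (1 - q) * rnorm (p - series d N) <= e * (1 - q) / 2 * q ^+ N.
  apply/ler_addgt0Pr => r r0.
  have [M _ dM] := (cvg_rnormP _ _).1 dp _ r0.
  have /= {}dM := dM (N + M)%N (leq_addl _ _).
  rewrite -(subrKA (series d (N + M)%N)).
  apply: (@le_trans _ _ ((1 - q) * (rnorm (p - series d (N + M)%N)
     + rnorm (series d (N + M)%N - series d N)))).
    by rewrite ler_wpM2l ?ler_rnormD// subr_ge0 ltW.
  rewrite mulrDr addrC lerD//.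
    rewrite (le_trans (Sle _))// ler_piMr//.
      by rewrite mulr_ge0 ?exprn_ge0 1?ltW.
    by rewrite gerBl exprn_ge0// ltW.
  rewrite (le_trans _ (ltW dM))// ler_piMl ?rnorm_ge0//.
  by rewrite gerBl ltW.
rewrite /= sub0r normrN ger0_norm; last first.
  by rewrite mulr_ge0 ?rnorm_ge0// exprn_ge0// invr_ge0 ltW.
rewrite exprVn mulrC ltr_pdivrMr ?exprn_gt0//.
rewrite -(ltr_pM2l (_ : 0 < 1 - q)) ?subr_gt0// (le_lt_trans tail)//.
rewrite mulrA [(1 - q) * e]mulrC ltr_pM2r ?exprn_gt0//.
by rewrite ltr_pdivrMr// ltr_pMr ?ltr1n// mulr_gt0// subr_gt0.
Qed.

End real_norm.

(** Once [a] stays below e(1 - q)/2, the recursion is dominated by the affine map t -> qt + e(1 -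
    q)/2, whose fixed point is e/2; its iterates approach that point geometrically. *)
Lemma cvg0_contraction (R : realType) (u a : nat -> R) (q : R) :
  0 < q -> q < 1 -> (forall n, 0 <= u n) ->
  (forall n, u n.+1 <= q * u n + a n) -> a @ \oo --> 0 -> u @ \oo --> 0.
Proof.
move=> q0 q1 u0 uS a0; apply/cvgrPdist_lt => e e0.
have e'0 : 0 < e * (1 - q) / 2 by rewrite divr_gt0// mulr_gt0// subr_gt0.
move/cvgrPdist_lt : a0 => /(_ _ e'0)[N _ aN].
have uN m : u (N + m)%N <= u N * q ^+ m + e / 2.
  elim: m => [|m IH]; first by rewrite addn0 expr0 mulr1 lerDl divr_ge0// ltW.
  rewrite addnS (le_trans (uS _))//.
  have /= := aN _ (leq_addr m N); rewrite sub0r normrN => /ltW.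
  move=> /(le_trans (ler_norm _)) aNm.
  rewrite (le_trans (lerD (ler_wpM2l (ltW q0) IH) aNm))//.
  by rewrite exprS le_eqVlt; apply/orP; left; apply/eqP; field.
have e20 : 0 < e / 2 by rewrite divr_gt0.
have /cvgrPdist_lt /(_ _ e20)[M _ qM] : geometric (u N) q @ \oo --> 0.
  by apply: cvg_geometric; rewrite (ger0_norm (ltW q0)).
exists (N + M)%N => // n NMn; rewrite sub0r normrN ger0_norm//.
have Nn : (N <= n)%N by rewrite (leq_trans _ NMn)// leq_addr.
rewrite -(subnKC Nn) (le_lt_trans (uN _))// [ltRHS]splitr ltrD2r.
have /qM /= : (M <= n - N)%N by rewrite leq_subRL.
by rewrite sub0r normrN; exact: le_lt_trans (ler_norm _).
Qed.

(** Here [p] is any point: this serves the space in which the series is not known to converge.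
    Removing one more term gives u_(k+1) <= q u_k + q (q^k |d_k|), a contraction with vanishing
    error. *)
Lemma cvg_scaled_series_remainder (R : realType) (V : normedModType R[i])
    (d : nat -> V) (p : V) (q : R) : 0 < q -> q < 1 ->
  q ^+ k * rnorm (d k) @[k --> \oo] --> 0 ->
  q ^+ k * rnorm (p - series d k) @[k --> \oo] --> 0.
Proof.
move=> q0 q1 d0.
apply: (@cvg0_contraction _ _ (fun k => q * (q ^+ k * rnorm (d k))) q q0 q1).
- by move=> n; rewrite mulr_ge0 ?rnorm_ge0// exprn_ge0// ltW.
- move=> n; rewrite seriesSr opprD addrA exprS -mulrDr -mulrA.
  by rewrite -mulrDr ler_pM2l// ler_pM2l ?exprn_gt0// ler_rnormB.
- by rewrite -[X in _ --> X](mulr0 q); exact: cvgMr.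
Qed.

(** * Two-sided sums, [UC] sequences and perturbation of the [UC] norm *)

Section two_sided_sums.
Context {R : realType}.

Lemma cvg_zlimit_diag : (k, k) @[k --> \oo] --> zlimit.
Proof.
by apply: (@cvg_pair _ _ _ \oo \oo \oo _ _ _ id id); exact: cvg_id.
Qed.

Lemma zpartialE (M : zmodType) (b : int -> M) p :
  zpartial b p = series (fun k => b (- k.+1%:Z)) p.1
               + series (fun k => b k%:Z) p.2.
Proof. by []. Qed.

Lemma zpartial_eventually (M : zmodType) (b : int -> M) (N : nat) :
  (forall k, (N <= k)%N -> b (- k.+1%:Z) = 0 /\ b k%:Z = 0) ->
  \forall p \near zlimit, zpartial b p = zpartial b (N, N).
Proof.
move=> bN; exists ([set n | (N <= n)%N], [set n | (N <= n)%N]).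
  by split; exists N.
move=> [m n] /= [Nm Nn]; rewrite /zpartial /=.
rewrite (big_cat_nat (leq0n N) Nm) (big_cat_nat (leq0n N) Nn)/=.
congr (_ + _); rewrite [X in _ + X]big_nat_cond [X in _ + X]big1 ?addr0//.
  by move=> k /andP[/andP[/bN[]]].
by move=> k /andP[/andP[/bN[]]].
Qed.

Lemma finite_set_int_bound (A : set int) : finite_set A ->
  exists N, forall k, (N <= k)%N -> ~ A (- k.+1%:Z) /\ ~ A k%:Z.
Proof.
move=> Afin; exists (\max_(n <- fset_set A) `|n|).+1 => k Nk.
have lt n : A n -> (`|n| < k)%N.
  move=> An; apply: leq_trans Nk; rewrite ltnS.
  by apply: (leq_bigmax_seq (F := absz)) => //; rewrite in_fset_set// inE.
split=> /lt; last by rewrite absz_nat ltnn.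
by rewrite abszN absz_nat ltnNge leqnSn.
Qed.

(** Extending [mu] by 0 to the negative indices gives admissible coefficients; the two-sided limit
    is then read along the diagonal. *)
Lemma UC_cvg_pos (V : normedModType R[i]) (b : int -> V) (mu : nat -> R[i]) :
  UC b -> (forall k, `|mu k| <= 1) -> cvgn (series (fun k => mu k *: b k%:Z)).
Proof.
move=> bUC mu1.
pose lam n := if n is Posz k then mu k else 0.
have /bUC/cvg_ex[l bl] : unit_bounded lam.
  by case=> k /=; rewrite ?mu1// normr0.
apply/cvg_ex; exists l; have := cvg_comp _ _ cvg_zlimit_diag bl.
apply: cvg_trans; apply: near_eq_cvg; near=> k.
rewrite /= zpartialE/= [X in X + _](_ : _ = 0) ?add0r//.
by rewrite /series/= big1// => i _; rewrite /lam scale0r.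
Unshelve. all: by end_near. Qed.

Lemma UC_cvg_neg (V : normedModType R[i]) (b : int -> V) (mu : nat -> R[i]) :
  UC b -> (forall k, `|mu k| <= 1) ->
  cvgn (series (fun k => mu k *: b (- k.+1%:Z))).
Proof.
move=> bUC mu1.
pose lam n := if n is Negz k then mu k else 0.
have /bUC/cvg_ex[l bl] : unit_bounded lam.
  by case=> k /=; rewrite ?mu1// normr0.
apply/cvg_ex; exists l; have := cvg_comp _ _ cvg_zlimit_diag bl.
apply: cvg_trans; apply: near_eq_cvg; near=> k.
rewrite /= zpartialE/= [X in _ + X](_ : _ = 0) ?addr0//.
by rewrite /series/= big1// => i _; rewrite /lam scale0r.
Unshelve. all: by end_near. Qed.

Lemma rnorm_cvg0 (V : normedModType R[i]) (u : nat -> V) :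
  u @ \oo --> 0 -> rnorm (u k) @[k --> \oo] --> 0.
Proof.
move=> /cvg_rnormP u0; apply/cvgrPdist_lt => e /u0; apply: filterS => k.
by rewrite !sub0r rnormN normrN ger0_norm// rnorm_ge0.
Qed.

Lemma UC_cvg0 (V : normedModType R[i]) (b : int -> V) : UC b ->
  rnorm (b (- k.+1%:Z)) @[k --> \oo] --> 0 /\ rnorm (b k%:Z) @[k --> \oo] --> 0.
Proof.
move=> bUC; split; apply: rnorm_cvg0; apply: cvg_series_cvg_0.
  have := @UC_cvg_neg _ _ (fun=> 1) bUC.
  by under eq_fun do rewrite scale1r; apply=> k; rewrite normr1.
have := @UC_cvg_pos _ _ (fun=> 1) bUC.
by under eq_fun do rewrite scale1r; apply=> k; rewrite normr1.
Qed.

Lemma UC_finite_support (V : normedModType R[i]) (b : int -> V) :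
  finite_set [set n | b n != 0] -> UC b.
Proof.
move=> /finite_set_int_bound[N bN] lam _; apply/cvg_ex.
exists (zpartial (fun n => lam n *: b n) (N, N)); apply: cvg_near_cst.
apply: zpartial_eventually => k /bN[/negP bk1 /negP bk2].
by split; apply/eqP; rewrite scaler_eq0 -[X in _ || X]negbK ?bk1 ?bk2 orbT.
Qed.

Lemma sum_pick (V : zmodType) (F : {fset int}) (a : int) (v : V) :
  \sum_(n <- F) (if n == a then v else 0) = if a \in F then v else 0.
Proof.
case: ifPn => aF.
  rewrite (bigD1_seq a aF (fset_uniq F)) eqxx big1/= ?addr0//.
  by move=> i /negPf ->.
rewrite big_seq big1// => i iF; case: eqP => // ia.
by rewrite ia (negPf aF) in iF.
Qed.

(** Setting entries to 0 cannot raise the norm, since 0 is an admissible coefficient; only the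
    entries at [a] and [b] can add to it. *)
Lemma UC_norm_perturb (V : normedModType R[i]) (w w' : int -> V) (a b : int) :
  (forall n, n != a -> n != b -> w' n = w n \/ w' n = 0) ->
  (UC_norm w' <= UC_norm w + (rnorm (w' a) + rnorm (w' b))%:E)%E.
Proof.
move=> w'w; apply/ereal_supP => _ [F [lam [lam1 ->]]].
(* The sum of [mu n *: w n] over the same [F] competes in the supremum defining [UC_norm w]. *)
pose mu n := if (n == a) || (n == b) || (w' n != w n) then 0 else lam n.
have mu1 : unit_bounded mu.
  by move=> n; rewrite /mu; case: ifP => _ //; rewrite normr0.
(* The inner test [a == b] prevents the same entry from being counted twice. *)
have split_term n : lam n *: w' n = mu n *: w n
    + ((if n == a then lam a *: w' a else 0)
     + (if n == b then (if a == b then 0 else lam b *: w' b) else 0)).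
  rewrite /mu; have [->|na] := eqVneq n a.
    by case: eqP => [_|_]; rewrite /= scale0r add0r ?addr0.
  have [nb|nb] := eqVneq n b.
    by rewrite -nb [a == n]eq_sym (negPf na)/= scale0r !add0r.
  rewrite /= !addr0; have [->|ww] := eqVneq (w' n) (w n) => //=.
  by have [/eqP|->] := w'w _ na nb; rewrite ?(negPf ww)// scale0r scaler0.
rewrite (eq_bigr _ (fun n _ => split_term n)) !big_split/= !sum_pick.
apply: (@le_trans _ _ ((rnorm (\sum_(n <- F) mu n *: w n))%:E
                       + (rnorm (w' a) + rnorm (w' b))%:E)%E); last first.
  by rewrite leeD2r//; apply: ereal_sup_ubound; exists F, mu.
rewrite -EFinD lee_fin (le_trans (ler_rnormD _ _))// lerD2l.
rewrite (le_trans (ler_rnormD _ _))// lerD//.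
  by case: ifP => _; rewrite ?rnorm0 ?rnorm_ge0// ler_rnormZ.
by case: ifP => _; [case: ifP => _|]; rewrite ?rnorm0 ?rnorm_ge0// ler_rnormZ.
Qed.

End two_sided_sums.

(** * The weights as powers of a fixed ratio *)

Section weights.
Local Open Scope complex_scope.
Context {R : realType}.
Implicit Types (theta : R) (k : nat).

Lemma rnorm_weighted (V : normedModType R[i]) theta j (b : int -> V) n :
  rnorm (weighted theta j b n) = 2 `^ ((j%:R - theta) * n%:~R) * rnorm (b n).
Proof. by rewrite rnormZ_ge0// powR_ge0. Qed.

Lemma powR_mul_pos (s : R) k : 2 `^ (s * k%:Z%:~R) = (2 `^ s) ^+ k.
Proof. by rewrite powRrM -powR_mulrn ?powR_ge0. Qed.

Lemma powR_mul_neg (s : R) k :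
  2 `^ (s * (- k.+1%:Z)%:~R) = (2 `^ s)^-1 ^+ k.+1.
Proof. by rewrite mulrNz mulrN -mulNr powR_mul_pos powRN. Qed.

Lemma powR2_gt1 (s : R) : 0 < s -> 1 < 2 `^ s.
Proof.
move=> s0; have : 1 `^ s < 2 `^ s :> R.
  by apply: gt0_ltr_powR; rewrite ?nnegrE ?ltr1n ?ler01 ?ler0n.
by rewrite powR1.
Qed.

End weights.

(** * Convergence in the sum space and in the ambient space *)

Section banach_pair.
Context {R : realType} {B : banach_pair R}.
Implicit Types (c : int -> pair_cap B) (x : pair_cap B) (v : ambient B).

Lemma sum_norm_ge0 v : (0 <= sum_norm v)%E.
Proof.
apply/ereal_infP => _ [b0 [b1 [_ ->]]].
by rewrite lee_fin addr_ge0// rnorm_ge0.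
Qed.

Lemma sum_norm0 : sum_norm (0 : ambient B) = 0%E.
Proof.
apply/eqP; rewrite eq_le sum_norm_ge0 andbT.
apply: ereal_inf_lbound; exists 0, 0.
by rewrite !linear0 addr0 !rnorm0 addr0.
Qed.

(** The sum space embeds continuously: a small sum norm gives a decomposition with two small pieces,
    and both embeddings are continuous at 0. *)
Lemma cvg_sum_norm {T : Type} {F : set_system T} {FF : Filter F}
    (f : T -> ambient B) v :
  sum_norm (v - f t) @[t --> F] --> 0%E -> f @ F --> v.
Proof.
move=> f0 U vU.
(* [g] recovers [f t] from any decomposition of [v - f t]. *)
pose g (b : space0 B * space1 B) : ambient B :=
  v - (emb0 B b.1 + emb1 B b.2).
have gc : g b @[b --> (0, 0)] --> v.
  have gE : v - (emb0 B 0 + emb1 B 0) = v by rewrite !linear0 addr0 subr0.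
  rewrite -[X in _ --> X]gE.
  apply: (@continuous2_cvg _ _ _ _ _ _ _ _ (fun a b => a - b)).
  - exact: (@sub_continuous (ambient B) (_, _)).
  - exact: cvg_cst.
  - apply: (@continuous2_cvg _ _ _ _ _ _ _ _ (fun a b => a + b)).
    + exact: (@tvs.add_continuous (ambient B) (_, _)).
    + by apply: cvg_comp; [exact: cvg_fst|exact: emb0_continuous].
    + by apply: cvg_comp; [exact: cvg_snd|exact: emb1_continuous].
have [[A0 A1] /= [/nbhs0_rnorm[r0 r00 rA0] /nbhs0_rnorm[r1 r10 rA1]] sub] :=
  gc _ vU.
pose r := Num.min r0 r1; have r_gt0 : 0 < r by rewrite lt_min r00.
have : \forall y \near 0%E, (y < r%:E)%E.
  apply/nbhs_EFin; apply: filterS (lt_nbhsl r_gt0) => z.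
  by rewrite lte_fin.
(* An infimum below [r] is witnessed by a decomposition whose two norms are each below [r]. *)
move=> /f0; apply: (@filterS _ F FF) => t /= /ereal_inf_lt[_ [b0 [b1 [bE ->]]]].
rewrite lte_fin => blt.
have /sub : (A0 `*` A1) (b0, b1).
  split => /=.
    apply: rA0; rewrite (le_lt_trans _ (lt_le_trans blt _))//.
      by rewrite lerDl rnorm_ge0.
    by rewrite ge_min lexx.
  apply: rA1; rewrite (le_lt_trans _ (lt_le_trans blt _))//.
    by rewrite lerDr rnorm_ge0.
  by rewrite ge_min lexx orbT.
by rewrite /= /g /= bE subKr.
Qed.

Lemma series_linear (V W : lmodType R[i]) (f : {linear V -> W}) (u : nat -> V)
    n : f (series u n) = series (f \o u) n.
Proof. by rewrite /series/= linear_sum. Qed.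

Lemma series_cap0 (u : nat -> pair_cap B) n :
  emb0 B (series (fun k => cap0 (u k)) n)
  = series (fun k => u k : ambient B) n.
Proof.
by rewrite series_linear; congr (series _ n); apply/funext => k /=;
  exact: emb_cap0.
Qed.

Lemma series_cap1 (u : nat -> pair_cap B) n :
  emb1 B (series (fun k => cap1 (u k)) n)
  = series (fun k => u k : ambient B) n.
Proof.
by rewrite series_linear; congr (series _ n); apply/funext => k /=;
  exact: emb_cap1.
Qed.

(** The two-sided partial sums converge in the ambient space both to [x] and to the sum of the
    one-sided limits; the Hausdorff property identifies the two. *)
Lemma sum_converges_split c x (pm : space0 B) (pp : space1 B) :
  sum_converges c x ->
  series (fun k => cap0 (c (- k.+1%:Z))) @ \oo --> pm ->
  series (fun k => cap1 (c k%:Z)) @ \oo --> pp ->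
  emb0 B pm + emb1 B pp = x :> ambient B.
Proof.
move=> /cvg_sum_norm cx cpm cpp.
apply: (cvg_unique (@ambient_hausdorff _ B) _ cx).
apply: cvg_trans (_ : emb0 B (series (fun k => cap0 (c (- k.+1%:Z))) p.1)
  + emb1 B (series (fun k => cap1 (c k%:Z)) p.2) @[p --> zlimit] --> _).
  apply: near_eq_cvg; near=> p.
  by rewrite series_cap0 series_cap1.
apply: (@continuous2_cvg _ _ _ _ _ _ _ _ (fun a b => a + b)).
- exact: (@tvs.add_continuous (ambient B) (_, _)).
- apply: (@cvg_comp _ _ _ _ (emb0 B) _ (nbhs pm)); last exact: emb0_continuous.
  exact: (cvg_comp _ _ cvg_fst cpm).
- apply: (@cvg_comp _ _ _ _ (emb1 B) _ (nbhs pp)); last exact: emb1_continuous.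
  exact: (cvg_comp _ _ cvg_snd cpp).
Unshelve. all: by end_near. Qed.

(** * Tails and truncation of a representation *)

Definition pair_cap_zero : pair_cap B :=
  PairCap (linear0 (emb0 B)) (linear0 (emb1 B)).

(* Both tails of a representation lie in the intersection: on each side, one
   preimage is a convergent tail, the other is what the rest of the sum leaves
   of x. *)
Lemma tail_neg_emb1 c x (pm : space0 B) (pp : space1 B) (N : nat) :
  emb0 B pm + emb1 B pp = x :> ambient B ->
  emb1 B (cap1 x - pp - series (fun k => cap1 (c (- k.+1%:Z))) N)
  = emb0 B (pm - series (fun k => cap0 (c (- k.+1%:Z))) N).
Proof.
move=> px; rewrite !linearB/= series_cap1 series_cap0 emb_cap1 -px.
by rewrite addrK.
Qed.

Lemma tail_pos_emb0 c x (pm : space0 B) (pp : space1 B) (N : nat) :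
  emb0 B pm + emb1 B pp = x :> ambient B ->
  emb0 B (cap0 x - pm - series (fun k => cap0 (c k%:Z)) N)
  = emb1 B (pp - series (fun k => cap1 (c k%:Z)) N).
Proof.
move=> px; rewrite !linearB/= series_cap1 series_cap0 emb_cap0 -px.
by rewrite [emb0 B pm + _]addrC addrK.
Qed.

(** As [Negz k] is -k-1, each side keeps N terms; [tm] sits at -N-1 and [tp] at N. *)
Definition truncate c (tm tp : pair_cap B) (N : nat) (n : int) : pair_cap B :=
  match n with
  | Posz k => if (k < N)%N then c n else if k == N then tp else pair_cap_zero
  | Negz k => if (k < N)%N then c n else if k == N then tm else pair_cap_zero
  end.

Lemma truncate_zero c tm tp (N k : nat) : (N < k)%N ->
  truncate c tm tp N (- k.+1%:Z) = pair_cap_zero /\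
  truncate c tm tp N k%:Z = pair_cap_zero.
Proof.
by move=> Nk; rewrite -NegzE /truncate ltnNge (ltnW Nk)/= gtn_eqF.
Qed.

(** From [(N.+1, N.+1)] on, the partial sums are constant; the hypothesis says that this constant is
    [x]. *)
Lemma sum_converges_truncate c x (tm tp : pair_cap B) (N : nat) :
  series (fun k => c (- k.+1%:Z) : ambient B) N + (tm : ambient B)
    + (series (fun k => c k%:Z : ambient B) N + (tp : ambient B)) = x :> ambient B ->
  sum_converges (truncate c tm tp N) x /\ J0 (truncate c tm tp N).
Proof.
move=> cx; split; last first.
  apply: (@sub_finite_set _ _ ([set k%:Z | k in `I_N.+1]
                          `|` [set Negz k | k in `I_N.+1])).
    case=> k nz; [left|right]; exists k => //=; rewrite ltnS leqNgt;
      apply: contra nz => Nk; have [zm zp] := truncate_zero c tm tp Nk.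
      by rewrite zp.
    by rewrite NegzE zm.
  by rewrite finite_setU; split; apply: finite_image; exact: finite_II.
apply: cvg_near_cst.
have : \forall p \near zlimit,
    zpartial (fun n => truncate c tm tp N n : ambient B) p =
    zpartial (fun n => truncate c tm tp N n : ambient B) (N.+1, N.+1).
  apply: zpartial_eventually => k Nk.
  by have [-> ->] := truncate_zero c tm tp Nk.
apply: filterS => p ->; rewrite zpartialE/= !seriesSr -!NegzE /= ltnn eqxx.
rewrite [X in sum_norm X](_ : _ = 0) ?sum_norm0//.
apply/eqP; rewrite subr_eq0 -cx.
apply/eqP; congr (_ + _ + (_ + _)); rewrite /series/=;
  by apply: eq_big_nat => k /andP[_ kN]; rewrite -?NegzE /= kN.
Qed.

(** Stated for a general [f] so as to apply to both [cap0] and [cap1]. *)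
Lemma UC_norm_truncate (V : normedModType R[i]) (f : pair_cap B -> V)
    (theta : R) (j : nat) c tm tp (N : nat) : f pair_cap_zero = 0 ->
  (UC_norm (weighted theta j (fun n => f (truncate c tm tp N n)))
   <= UC_norm (weighted theta j (fun n => f (c n)))
      + (2 `^ ((j%:R - theta) * (- N.+1%:Z)%:~R) * rnorm (f tm)
         + 2 `^ ((j%:R - theta) * N%:Z%:~R) * rnorm (f tp))%:E)%E.
Proof.
move=> f0; set w' := weighted _ _ (fun n => f (truncate _ _ _ _ _)).
have <- : rnorm (w' (- N.+1%:Z)) = 2 `^ ((j%:R - theta) * (- N.+1%:Z)%:~R)
    * rnorm (f tm).
  by rewrite rnorm_weighted -NegzE /= ltnn eqxx.
have <- : rnorm (w' N%:Z) = 2 `^ ((j%:R - theta) * N%:Z%:~R) * rnorm (f tp).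
  by rewrite rnorm_weighted /= ltnn eqxx.
apply: UC_norm_perturb => -[] k; rewrite -?NegzE => na nb;
  rewrite /w' /weighted /=; case: ltnP => kN; [by left| |by left|];
  right; case: eqP => kE; rewrite ?f0 ?scaler0//.
- by rewrite kE eqxx in nb.
- by rewrite kE eqxx in na.
Qed.

End banach_pair.

(** * Truncation at arbitrarily small extra cost *)

Section truncation_cost.
Context {R : realType} {B : banach_pair R} {theta : R}.
Context (theta0 : 0 < theta) (theta1 : theta < 1).
Implicit Types (c : int -> pair_cap B) (x : pair_cap B).

(** The weight at n is [q0] to the n in the first space and [q1] to the -n in the second. Both
    ratios are below 1, so the weights grow towards -oo and +oo respectively, which is where the
    unweighted series converges. *)
Let q0 : R := 2 `^ (- theta).
Let q1 : R := 2 `^ (theta - 1).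

Let q0_gt0 : 0 < q0. Proof. exact: powR_gt0. Qed.
Let q1_gt0 : 0 < q1. Proof. exact: powR_gt0. Qed.

Let q0_lt1 : q0 < 1.
Proof. by rewrite /q0 powRN invf_lt1 ?powR_gt0// powR2_gt1. Qed.

Let q1_lt1 : q1 < 1.
Proof.
by rewrite /q1 -opprB powRN invf_lt1 ?powR_gt0// powR2_gt1// subr_gt0.
Qed.

Let weight0_pos k : 2 `^ ((0%:R - theta) * k%:Z%:~R) = q0 ^+ k.
Proof. by rewrite sub0r powR_mul_pos. Qed.

Let weight0_neg k : 2 `^ ((0%:R - theta) * (- k.+1%:Z)%:~R) = q0^-1 ^+ k.+1.
Proof. by rewrite sub0r powR_mul_neg. Qed.

Let weight1_pos k : 2 `^ ((1%:R - theta) * k%:Z%:~R) = q1^-1 ^+ k.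
Proof. by rewrite powR_mul_pos /q1 -[theta - 1]opprB powRN invrK. Qed.

Let weight1_neg k : 2 `^ ((1%:R - theta) * (- k.+1%:Z)%:~R) = q1 ^+ k.+1.
Proof. by rewrite powR_mul_neg /q1 -[theta - 1]opprB powRN. Qed.

(** Negative indices start at -1, so their weights carry the exponent [k.+1], whereas the estimates
    on series use [k]. *)
Let cvg0_shift (q : R) (u : nat -> R) : q != 0 ->
  q ^+ k.+1 * u k @[k --> \oo] --> 0 <-> q ^+ k * u k @[k --> \oo] --> 0.
Proof.
move=> q_neq0; split => u0.
  rewrite (_ : (fun k => _) = (fun k => q^-1 * (q ^+ k.+1 * u k))).
    by rewrite -[X in _ --> X](mulr0 q^-1); exact: cvgMr.
  by apply/funext => k; rewrite exprS -mulrA mulKf.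
rewrite (_ : (fun k => _) = (fun k => q * (q ^+ k * u k))).
  by rewrite -[X in _ --> X](mulr0 q); exact: cvgMr.
by apply/funext => k; rewrite exprS -mulrA.
Qed.

Let norm_expr_le1 (q : R) k : 0 < q -> q < 1 ->
  `|real_complex R (q ^+ k)| <= 1.
Proof.
move=> q_gt0 q_lt1.
have q1c : real_complex R (q ^+ k) <= real_complex R 1.
  by rewrite lecR exprn_ile1 ?ltW.
by rewrite ger0_norm ?q1c// ler0c exprn_ge0// ltW.
Qed.

(** Growing weights meet the genuine tail of a convergent series ([cvg_scaled_series_tail]);
    decaying weights meet the other preimage ([cvg_scaled_series_remainder]). *)
Lemma representation_tails c x : peetre_representation theta x c ->
  exists tm tp : nat -> pair_cap B,
  [/\ forall N, sum_converges (truncate c (tm N) (tp N) N) x /\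
                J0 (truncate c (tm N) (tp N) N),
      q0^-1 ^+ N.+1 * rnorm (cap0 (tm N)) @[N --> \oo] --> 0 /\
      q0 ^+ N * rnorm (cap0 (tp N)) @[N --> \oo] --> 0 &
      q1 ^+ N.+1 * rnorm (cap1 (tm N)) @[N --> \oo] --> 0 /\
      q1^-1 ^+ N * rnorm (cap1 (tp N)) @[N --> \oo] --> 0].
Proof.
move=> [cx UC0 UC1].
have q0V_neq0 : q0^-1 != 0 by rewrite invr_neq0// gt_eqF.
have q1_neq0 : q1 != 0 by rewrite gt_eqF.
have [w0m w0p] := UC_cvg0 UC0; have [w1m w1p] := UC_cvg0 UC1.
do [under eq_fun do rewrite rnorm_weighted weight0_neg] in w0m.
do [under eq_fun do rewrite rnorm_weighted weight0_pos] in w0p.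
do [under eq_fun do rewrite rnorm_weighted weight1_neg] in w1m.
do [under eq_fun do rewrite rnorm_weighted weight1_pos] in w1p.
move/(cvg0_shift _ q0V_neq0) : w0m => w0m.
move/(cvg0_shift _ q1_neq0) : w1m => w1m.
(* The coefficients [mu] cancel the weights exactly, and are admissible because [q0] is below 1. *)
have [pm cpm] : exists pm : space0 B,
    series (fun k => cap0 (c (- k.+1%:Z))) @ \oo --> pm.
  apply/cvg_ex; pose mu k := real_complex R (q0 ^+ k.+1).
  have := @UC_cvg_neg _ _ _ mu UC0.
  rewrite (_ : (fun k => mu k *: _) = fun k => cap0 (c (- k.+1%:Z))).
    by apply=> k; exact: norm_expr_le1.
  apply/funext => k; rewrite /weighted weight0_neg scalerA -rmorphM/=.
  by rewrite exprVn divff ?scale1r// expf_neq0// gt_eqF.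
have [pp cpp] : exists pp : space1 B,
    series (fun k => cap1 (c k%:Z)) @ \oo --> pp.
  apply/cvg_ex; pose mu k := real_complex R (q1 ^+ k).
  have := @UC_cvg_pos _ _ _ mu UC1.
  rewrite (_ : (fun k => mu k *: _) = fun k => cap1 (c k%:Z)).
    by apply=> k; exact: norm_expr_le1.
  apply/funext => k; rewrite /weighted weight1_pos scalerA -rmorphM/=.
  by rewrite exprVn divff ?scale1r// expf_neq0// gt_eqF.
have px := sum_converges_split cx cpm cpp.
(* The ambient value is by definition the image of the convergent tail, hence [erefl] on that side;
   the other preimage starts from [cap1 x - pp], or from [cap0 x - pm] for [tp]. *)
pose tm N := PairCap erefl (tail_neg_emb1 c N px).
pose tp N := PairCap (tail_pos_emb0 c N px) erefl.
exists tm, tp; split.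
- move=> N; apply: sum_converges_truncate => /=.
  by rewrite !linearB/= series_cap0 series_cap1 !subrKC.
- split.
    apply/(cvg0_shift _ q0V_neq0).
    exact: cvg_scaled_series_tail.
  exact: cvg_scaled_series_remainder.
- split; last exact: cvg_scaled_series_tail.
  apply/(cvg0_shift _ q1_neq0).
  exact: cvg_scaled_series_remainder.
Qed.

Lemma peetre_cost_approx c x (e : R) : 0 < e ->
  peetre_representation theta x c ->
  exists c' : int -> pair_cap B, [/\ sum_converges c' x, J0 c' &
    (peetre_cost theta c' <= peetre_cost theta c + e%:E)%E].
Proof.
move=> e0 /representation_tails[tm [tp [tE [m0 p0] [m1 p1]]]].
have small (u v : nat -> R) : u @ \oo --> 0 -> v @ \oo --> 0 ->
    \forall N \near \oo, u N + v N < e.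
  move=> u0 v0; have /cvgrPdist_lt/(_ _ e0) : u N + v N @[N --> \oo] --> 0.
    by rewrite -[X in _ --> X](addr0 0); exact: cvgD.
  apply: filterS => N; rewrite sub0r normrN.
  exact: le_lt_trans (ler_norm _).
(* A single [N] must serve both spaces, since the same truncation enters both norms. *)
have [N [N0 N1]] := filter_ex (filterI (small _ _ m0 p0) (small _ _ m1 p1)).
have [cx cJ] := tE N; exists (truncate c (tm N) (tp N) N); split => //.
rewrite /peetre_cost ge_max; apply/andP; split.
- apply: (le_trans (UC_norm_truncate theta 0 c _ _ N erefl)).
  rewrite weight0_neg weight0_pos; apply: leeD; last by rewrite lee_fin ltW.
  by rewrite le_max lexx.
- apply: (le_trans (UC_norm_truncate theta 1 c _ _ N erefl)).
  rewrite weight1_neg weight1_pos; apply: leeD; last by rewrite lee_fin ltW.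
  by rewrite le_max lexx orbT.
Qed.

(** [J0] speaks of ambient values; injectivity of the embeddings carries their vanishing to the
    preimages. *)
Lemma J0_representation c x : sum_converges c x -> J0 c ->
  peetre_representation theta x c.
Proof.
move=> cx cJ; split=> //; apply: UC_finite_support; apply: sub_finite_set cJ => n;
  apply: contra => /eqP cn0; rewrite /weighted.
- rewrite (_ : cap0 (c n) = 0) ?scaler0//.
  by apply: (@emb0_inj _ B); rewrite emb_cap0 linear0.
- rewrite (_ : cap1 (c n) = 0) ?scaler0//.
  by apply: (@emb1_inj _ B); rewrite emb_cap1 linear0.
Qed.

End truncation_cost.

Theorem mainTheorem3 (R : realType) (B : banach_pair R) (theta : R)
    (htheta0 : 0 < theta) (htheta1 : theta < 1) (x : pair_cap B) :
  peetre_norm theta (x : ambient B) =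
  ereal_inf [set peetre_cost theta c | c in
    [set c : int -> pair_cap B |
      sum_converges c (x : ambient B) /\ J0 c]].
Proof.
apply/eqP; rewrite eq_le; apply/andP; split.
  apply: ereal_inf_le_tmp => _ [c [cx cJ] <-].
  by exists c => //; exact: J0_representation.
(* Each representation is matched, up to [e], by a finitely supported one. *)
apply/ereal_infP => _ [c cx <-]; apply/lee_addgt0Pr => e e0.
have [c' [c'x c'J c'c]] := peetre_cost_approx htheta0 htheta1 e0 cx.
by apply: le_trans c'c; apply: ereal_inf_lbound; exists c'.
Qed.
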